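(* Let $p$ be an odd integer $\ge3$. Then $a_{\mathrm{dbl}}(L)$ satisfies \[a_{\mathrm{dbl}}(L)=p\,a_{\mathrm{dbl}}(L-1)-\tfrac{p-1}{2}\,a_{\mathrm{dbl}}(L-2)\quad(L\ge2),\] whose characteristic roots are $\lambda_{1,2}=\bigl(p\pm\sqrt{(p-1)^2+1}\bigr)/2$. For $p=2$, $a_{\mathrm{dbl}}(L)=2^L$.
   Context: For base $p$ and a digit string $(d_1,\dots,d_L)\in\{0,\dots,p-1\}^L$ (the base-$p$ digits of $m\in[0,p^L)$, least significant first), set $\sigma_0=0$ and $\sigma_j=\lfloor(2d_j+\sigma_{j-1})/p\rfloor$. The doubling of $m$ is cascade-free if there is no $j$ with $2d_j=p-1$ and $\sigma_{j-1}=1$. $a_{\mathrm{dbl}}(L)$ is the number of $m\in[0,p^L)$ whose doubling is cascade-free. *)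

(* Defs.v *)
From HB Require Import structures.
From mathcomp Require Import all_boot all_order all_algebra.

Set Implicit Arguments.
Unset Strict Implicit.
Unset Printing Implicit Defensive.

Import GRing.Theory.

(* Digit strings are indexed from 1, least significant digit first. *)
Definition digit (p m j : nat) : nat := (m %/ p ^ j.-1) %% p.

Fixpoint carry (p : nat) (d : nat -> nat) (j : nat) : nat :=
  if j is i.+1 then (2 * d i.+1 + carry p d i) %/ p else 0.

Definition cascade_free (p L m : nat) : bool :=
  let d := digit p m in
  ~~ has (fun j => (2 * d j == p - 1) && (carry p d j.-1 == 1)) (iota 1 L).

Definition a_dbl (p L : nat) : nat :=
  #|[set m : 'I_(p ^ L) | cascade_free p L m]|.

(* Characteristic polynomial of u(n) = c1 * u(n-1) + c2 * u(n-2). *)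
Definition rec2_char_poly (R : nzRingType) (c1 c2 : R) : {poly R} :=
  ('X^2 - c1 *: 'X - c2%:P)%R.

(* Main.v *)
(* Read the digits from the least significant one: the carry is the state of a
   two-state automaton.  For [p = 2h + 1], carry [0] is followed by carry [0]
   for [h + 1] digits and by carry [1] for [h] digits; carry [1] is followed by
   each carry for [h] digits, the digit [h] being forbidden.  The recurrence is
   Cayley-Hamilton for this transfer matrix, of trace [2h + 1 = p] and
   determinant [h (h + 1) - h ^ 2 = h]. *)
Require Import Defs.
From HB Require Import structures.
From mathcomp Require Import all_boot all_order all_algebra.
From mathcomp Require Import zify ring.

Import GRing.Theory Num.Theory.

(** With [b = p ^ L], this splits off the most significant digit [d]. *)
Lemma sum_nat_mul_split (a b : nat) (F : nat -> nat) :
  \sum_(m < a * b) F m = \sum_(d < a) \sum_(m < b) F (d * b + m).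
Proof.
elim: a => [|a IHa]; first by rewrite mul0n !big_ord0.
rewrite big_ord_recr /= -IHa mulSn addnC big_split_ord /=.
by congr (_ + _).
Qed.

Lemma digit_add_mul_low (p L d m j : nat) :
  0 < p -> 0 < j <= L -> digit p (d * p ^ L + m) j = digit p m j.
Proof.
move=> p0 /andP[j0 jL]; rewrite /digit.
(* The spare factor [p], available since [j <= L], makes the contribution of [d] vanish modulo
   [p]. *)
have -> : p ^ L = p ^ (L - j) * p * p ^ j.-1.
  by rewrite -expnSr -expnD; congr (_ ^ _); lia.
by rewrite !mulnA divnMDl ?expn_gt0 ?p0 // modnMDl.
Qed.

Lemma digit_add_mul_top (p L d m : nat) :
  d < p -> m < p ^ L -> digit p (d * p ^ L + m) L.+1 = d.
Proof.
move=> dp mL; rewrite /digit /= divnMDl; last by lia.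
by rewrite divn_small // addn0 modn_small.
Qed.

Lemma eq_carry (p : nat) (d e : nat -> nat) (j : nat) :
  (forall i, 0 < i <= j -> d i = e i) -> carry p d j = carry p e j.
Proof.
elim: j => //= j IHj de; rewrite de ?leqnn // IHj // => i /andP[i0 ij].
by rewrite de // i0 ltnW.
Qed.

Lemma carry_add_mul_low (p L d m j : nat) : 0 < p -> j <= L ->
  carry p (digit p (d * p ^ L + m)) j = carry p (digit p m) j.
Proof.
move=> p0 jL; apply: eq_carry => i /andP[i0 ij].
by rewrite digit_add_mul_low // i0 (leq_trans ij).
Qed.

(** By induction, since [2 * (p - 1) + 1 < 2 * p]; hence the automaton has two states. *)
Lemma carry_le1 (p m j : nat) : 0 < p -> carry p (digit p m) j <= 1.
Proof.
move=> p0; elim: j => //= j IHj.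
have dp : digit p m j.+1 < p by rewrite ltn_mod.
by rewrite -ltnS ltn_divLR //; lia.
Qed.

Definition free_step (p s d : nat) : bool := ~~ ((2 * d == p - 1) && (s == 1)).

(** A new top digit changes no lower digit or carry, so only position [L.+1] adds a condition. *)
Lemma cascade_free_add_mul (p L d m : nat) : d < p -> m < p ^ L ->
  cascade_free p L.+1 (d * p ^ L + m)
  = cascade_free p L m && free_step p (carry p (digit p m) L) d.
Proof.
move=> dp mL; have p0 : 0 < p by lia.
have iotaS : iota 1 L.+1 = iota 1 L ++ [:: L.+1].
  by rewrite -[L.+1]addn1 iotaD addn1.
rewrite /cascade_free iotaS has_cat negb_or /= orbF.
rewrite digit_add_mul_top // carry_add_mul_low //; congr (~~ _ && _).
apply: eq_in_has => j; rewrite mem_iota => jL.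
by rewrite digit_add_mul_low ?carry_add_mul_low //; lia.
Qed.

(** The state vector of the automaton after [L] digits. *)
Definition free_count (p L c : nat) : nat :=
  \sum_(m < p ^ L) (cascade_free p L m && (carry p (digit p m) L == c)).

(** The transfer matrix entry from carry [s] to carry [c]. *)
Definition step_count (p s c : nat) : nat :=
  \sum_(d < p) (free_step p s d && ((2 * d + s) %/ p == c)).

Lemma a_dblE (p L : nat) : 0 < p ->
  a_dbl p L = free_count p L 0 + free_count p L 1.
Proof.
move=> p0; rewrite /a_dbl /free_count -sum1dep_card big_mkcond -big_split /=.
apply: eq_bigr => m _; have := carry_le1 p m L p0.
by case: (cascade_free _ _ _) => //; case: (carry _ _ _) => [|[]].
Qed.

Lemma free_countS (p L c : nat) : 0 < p ->
  free_count p L.+1 c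
  = free_count p L 0 * step_count p 0 c + free_count p L 1 * step_count p 1 c.
Proof.
move=> p0; pose F m : nat := cascade_free p L.+1 m && (carry p (digit p m) L.+1 == c).
rewrite /free_count expnS (sum_nat_mul_split p _ F) exchange_big {}/F /=.
rewrite !big_distrl -big_split /=; apply: eq_bigr => m _.
under eq_bigr => d _ do
  rewrite cascade_free_add_mul // digit_add_mul_top // carry_add_mul_low //.
have := carry_le1 p m L p0; rewrite /step_count.
(* A string that already cascades contributes 0 to both sides; otherwise its carry selects one
   matrix row. *)
case: (cascade_free _ _ _) => /=; last by rewrite big1.
by case: (carry _ _ _) => [|[|//]] _ /=; rewrite mul0n mul1n ?addn0.
Qed.

Lemma sum_split_middle (h : nat) (F : nat -> nat) :
  \sum_(d < h.*2.+1) F d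
  = \sum_(d < h) F d + F h + \sum_(d < h) F (h.+1 + d).
Proof.
have -> : h.*2.+1 = h.+1 + h by lia.
by rewrite big_split_ord /= big_ord_recr.
Qed.

(** Digits below [h] give carry 0 and those above [h] give carry 1, whatever [s] is. The middle
    digit [h] gives carry 0 if [s = 0] and is forbidden if [s = 1]. *)
Lemma step_countE (h s c : nat) : s <= 1 ->
  step_count h.*2.+1 s c
  = h * (c == 0) + (s == 0) * (c == 0) + h * (c == 1).
Proof.
move=> s1; pose F d : nat :=
  free_step h.*2.+1 s d && ((2 * d + s) %/ h.*2.+1 == c).
rewrite /step_count (sum_split_middle h F) {}/F.
congr (_ + _ + _).
- rewrite -[h in RHS]card_ord -sum_nat_const; apply: eq_bigr => d _.
  have dh := ltn_ord d.
  by rewrite /free_step divn_small 1?eq_sym; lia.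
- rewrite /free_step; case: s s1 => [|[|//]] _ /=.
    by rewrite divn_small 1?eq_sym; lia.
  by have -> : 2 * h == h.*2.+1 - 1 by lia.
- rewrite -[h in RHS]card_ord -sum_nat_const; apply: eq_bigr => d _.
  have dh := ltn_ord d.
  have -> : 2 * (h.+1 + d) + s = 1 * h.*2.+1 + (d.*2 + 1 + s) by lia.
  by rewrite divnMDl // divn_small /free_step; lia.
Qed.

(** Stated additively to avoid truncated subtraction. Both sides expand to
    [(2h+1)^2 x + 2h(2h+1) y], where [x] and [y] are the entries of the state vector at [L]. *)
Lemma a_dbl_rec (h L : nat) :
  a_dbl h.*2.+1 L.+2 + h * a_dbl h.*2.+1 L
  = h.*2.+1 * a_dbl h.*2.+1 L.+1.
Proof. rewrite !a_dblE // !free_countS // !step_countE //=; nia. Qed.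

(** By parity [2 * d = 1] is impossible, so no cascade ever occurs. *)
Lemma a_dbl2 (L : nat) : a_dbl 2 L = 2 ^ L.
Proof.
rewrite /a_dbl -[RHS]card_ord -cardsT; congr #|pred_of_set _|.
apply/setP => m; rewrite !inE; apply/hasPn => j _; lia.
Qed.

Local Open Scope ring_scope.

Lemma rec2_char_polyE (R : comNzRingType) (x y : R) :
  rec2_char_poly (x + y) (- (x * y)) = ('X - x%:P) * ('X - y%:P).
Proof.
by rewrite /rec2_char_poly -mul_polyC polyCN polyCD polyCM; ring.
Qed.

Theorem theorem5p1 (R : rcfType) :
  (forall p : nat, odd p -> (3 <= p)%N ->
     let c1 : R := p%:R in
     let c2 : R := - ((p%:R - 1) / 2) in
     let lambda1 : R := (p%:R + Num.sqrt ((p%:R - 1) ^+ 2 + 1)) / 2 in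
     let lambda2 : R := (p%:R - Num.sqrt ((p%:R - 1) ^+ 2 + 1)) / 2 in
     [/\ forall L : nat, (2 <= L)%N ->
           (a_dbl p L)%:R
             = c1 * (a_dbl p (L - 1)%N)%:R + c2 * (a_dbl p (L - 2)%N)%:R,
         forall x : R,
           root (rec2_char_poly c1 c2) x <-> x = lambda1 \/ x = lambda2 &
         rec2_char_poly c1 c2
           = ('X - lambda1%:P) * ('X - lambda2%:P)])
  /\ (forall L : nat, a_dbl 2 L = (2 ^ L)%N).
Proof.
split; last exact: a_dbl2.
move=> p odd_p p3 c1 c2 lambda1 lambda2.
have polyE : rec2_char_poly c1 c2 = ('X - lambda1%:P) * ('X - lambda2%:P).
  rewrite -rec2_char_polyE; congr rec2_char_poly.
    by rewrite /lambda1 /lambda2 /c1; field.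
  set s := Num.sqrt _ in lambda1 lambda2 *.
  have s2 : s ^+ 2 = (p%:R - 1) ^+ 2 + 1.
    by rewrite sqr_sqrtr // addr_ge0 ?sqr_ge0 ?ler01.
  (* As [p^2 - (p - 1)^2 - 1 = 2 (p - 1)], the product of the roots is [(p - 1) / 2], which is
     [- c2]. *)
  have -> : lambda1 * lambda2 = (p%:R ^+ 2 - s ^+ 2) / 4.
    by rewrite /lambda1 /lambda2; field.
  by rewrite s2 /c2; field.
split=> // [L L2|x]; last first.
  rewrite polyE rootM !root_XsubC.
  by split=> [/orP[]/eqP|[]->]; rewrite ?eqxx ?orbT; auto.
have [K ->] : exists K, L = K.+2 by exists (L - 2)%N; lia.
have [h hE] : exists h, p = h.*2.+1 by exists p./2; lia.
have -> : (K.+2 - 1 = K.+1)%N by lia.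
have -> : (K.+2 - 2 = K)%N by lia.
have /(congr1 (fun n => n%:R : R)) := a_dbl_rec h K.
rewrite -hE natrD !natrM => rec.
have c2E : c2 = - h%:R by rewrite /c2 hE -addn1 -muln2 natrD natrM; field.
by rewrite c2E /c1 -rec; ring.
Qed.
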